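(* Let $\mathfrak{G}_m$ ($m\ge 1$) denote the set of (isomorphism classes of) all strongly connected directed graphs with $m$ arcs. For any $\Gamma\in\mathfrak{G}_m$, $$f_\Gamma> e\,\ln(m-\ln m).$$ Moreover, the following asymptotic formula holds: $$\min_{\Gamma\in\mathfrak{G}_m} f_\Gamma=e\,\ln m+O\!\left(\frac{1}{\ln m}\right)\quad\text{as } m\to\infty.$$
   Context: Graphs are finite and directed; loops and multiple (parallel) arcs are allowed. For a graph $\Gamma$ with arc set $\mathcal{A}(\Gamma)$, $f_\Gamma=\min \sum_{a\in\mathcal{A}(\Gamma)} x_a$, the minimum being over all vectors $(x_a)_{a\in\mathcal{A}(\Gamma)}$ with $x_a\ge 0$ such that $\prod_{a\in\gamma}x_a=1$ for every directed cycle $\gamma$ of $\Gamma$ (a closed directed path not passing through the same node twice; loops are cycles of length one). This minimum is attained. *)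

(* Defs.v *)
From HB Require Import structures.
From mathcomp Require Import all_boot all_order all_algebra.
From mathcomp Require Import all_classical all_reals all_analysis.

Set Implicit Arguments.
Unset Strict Implicit.
Unset Printing Implicit Defensive.

Import Order.TTheory GRing.Theory Num.Theory.
Import numFieldNormedType.Exports.

Local Open Scope classical_set_scope.
Local Open Scope ring_scope.

(* Arcs form a type of their own, so loops and parallel arcs are allowed. *)
Record digraph := Digraph {
  nodes : finType;
  arcs : finType;
  src : arcs -> nodes;
  tgt : arcs -> nodes }.

Definition adjacent (G : digraph) : rel (nodes G) :=
  fun u v => [exists a : arcs G, (src a == u) && (tgt a == v)].

Definition strongly_connected (G : digraph) : Prop :=
  forall u v : nodes G, connect (@adjacent G) u v.

(* A cycle is listed by its arcs [:: a_1; ..; a_k], k >= 1; its nodes are the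
   sources of these arcs, so a loop is a cycle of length one. *)
Definition directed_cycle (G : digraph) (c : seq (arcs G)) : bool :=
  [&& c != [::], cycle (fun a b => tgt a == src b) c & uniq (map (@src G) c)].

Section MinSum.
Variable R : realType.

Definition admissible (G : digraph) : set (arcs G -> R) :=
  [set x | (forall a, 0 <= x a) /\
           (forall c, directed_cycle c -> \prod_(a <- c) x a = 1)].

Definition arc_sums (G : digraph) : set R :=
  [set \sum_(a : arcs G) x a | x in @admissible G].

(* The infimum is a minimum, see [min_arc_sum_attained]. *)
Definition min_arc_sum (G : digraph) : R := inf (arc_sums G).

Definition min_arc_sums (m : nat) : set R :=
  [set r | exists G : digraph,
     [/\ strongly_connected G, #|arcs G| = m & r = min_arc_sum G]].

(* For m >= 1 the infimum is a minimum, see [min_over_graphs_attained]. *)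
Definition min_over_graphs (m : nat) : R := inf (min_arc_sums m).

Lemma inf_min (S : set R) (v : R) : S v -> lbound S v -> inf S = v.
Proof.
move=> Sv lbv; apply/eqP; rewrite eq_le; apply/andP; split.
  by apply: ge_inf => //; exists v.
by apply: lb_le_inf => //; exists v.
Qed.

Lemma continuous_prod_seq (T : topologicalType) (I : Type) (c : seq I)
    (F : I -> T -> R) : (forall i, continuous (F i)) ->
  continuous (fun x => \prod_(i <- c) F i x).
Proof.
move=> cF; elim: c => [|i c IH].
  rewrite (_ : (fun _ => _) = cst 1); last first.
    by apply/funext => x /=; rewrite big_nil.
  exact: cst_continuous.
rewrite (_ : (fun _ => _) = (fun x => F i x * \prod_(j <- c) F j x)).
  by move=> x; apply: continuousM; [exact: cF | exact: IH].
by apply/funext => x /=; rewrite big_cons.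
Qed.

Lemma continuous_sum_seq (T : topologicalType) (I : Type) (c : seq I)
    (F : I -> T -> R) : (forall i, continuous (F i)) ->
  continuous (fun x => \sum_(i <- c) F i x).
Proof.
move=> cF; elim: c => [|i c IH].
  rewrite (_ : (fun _ => _) = cst 0); last first.
    by apply/funext => x /=; rewrite big_nil.
  exact: cst_continuous.
rewrite (_ : (fun _ => _) = (fun x => F i x + \sum_(j <- c) F j x)).
  by move=> x; apply: continuousD; [exact: cF | exact: IH].
by apply/funext => x /=; rewrite big_cons.
Qed.

Lemma min_arc_sum_attained (G : digraph) :
  exists2 x, admissible x & \sum_(a : arcs G) x a = min_arc_sum G /\
    forall y, admissible y -> \sum_(a : arcs G) x a <= \sum_(a : arcs G) y a.
Proof.
pose T := prod_topology (fun _ : arcs G => R : topologicalType).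
pose box : set T := [set x | forall a, x a \in `[0 : R, #|arcs G|%:R]].
pose cyc : set T := \bigcap_(c in [set c | directed_cycle c])
  [set x : T | \prod_(a <- c) x a = 1].
pose K := cyc `&` box.
have cproj (a : arcs G) : continuous (fun x : T => x a : R).
  by move=> x; exact: (@proj_continuous _ (fun _ : arcs G => R) a).
have cprod c : continuous (fun x : T => \prod_(a <- c) x a : R).
  exact: continuous_prod_seq.
have csum c : continuous (fun x : T => \sum_(a <- c) x a : R).
  exact: continuous_sum_seq.
have compK : compact K.
  apply: (@subclosed_compact _ _ box); last by move=> x [].
    apply: closedI.
      apply: closed_bigI => c _.
      apply: (@closed_comp _ _ (fun x : T => \prod_(a <- c) x a : R) [set 1]).
        by move=> x _; exact: cprod.
      exact: closed_eq.
    have -> : box = \bigcap_(a in setT)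
        ((fun x : T => x a : R) @^-1` [set` `[0 : R, #|arcs G|%:R]]).
      by apply/seteqP; split=> x bx a => [_|]; exact: bx.
    apply: closed_bigI => a _; apply: closed_comp => [x _|]; first exact: cproj.
    exact: itv_closed.
  apply: (@tychonoff _ (fun _ : arcs G => R : topologicalType)
    (fun=> [set` `[0 : R, #|arcs G|%:R]])) => a.
  exact: segment_compact.
have K1 : K (fun=> 1).
  split=> [c _|a]; rewrite /= ?big1_eq //= in_itv /= ler01 ler1n.
  by apply/card_gt0P; exists a.
have [x Kx xmin] : exists2 x, x \in K &
    forall t, t \in K -> \sum_(a : arcs G) x a <= \sum_(a : arcs G) t a.
  apply: (@compact_EVT_min _ _ (fun x : T => \sum_(a : arcs G) x a : R) K) => //.
    by exists (fun=> 1).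
  by apply: continuous_subspaceT; exact: csum.
move: Kx; rewrite inE => -[xcyc xbox].
have admx : admissible x.
  split=> [a|c cP]; last exact: xcyc.
  by have := xbox a; rewrite /= in_itv /= => /andP[].
have minx y : admissible y -> \sum_(a : arcs G) x a <= \sum_(a : arcs G) y a.
  move=> [y0 ycyc].
  have [yle|/ltW yge] := leP (\sum_(a : arcs G) y a) #|arcs G|%:R.
    apply: xmin; rewrite inE; split=> [c cP|a]; first exact: ycyc.
    rewrite /= in_itv /= y0 /=; apply: le_trans yle.
    by rewrite (bigD1 a) //= lerDl sumr_ge0.
  apply: le_trans yge.
  have := xmin (fun=> 1); rewrite inE => /(_ K1) /le_trans; apply.
  by rewrite sumr_const.
exists x => //; split=> //; symmetry; apply: inf_min; first by exists x.
by move=> _ [y yadm <-]; exact: minx.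
Qed.

Lemma min_over_graphs_attained (m : nat) : (0 < m)%N ->
  exists2 G, strongly_connected G /\ #|arcs G| = m &
    min_arc_sum G = min_over_graphs m /\
    forall H, strongly_connected H /\ #|arcs H| = m ->
      min_arc_sum G <= min_arc_sum H.
Proof.
move=> m_gt0.
pose E := ({ffun 'I_m * 'I_m -> bool} * {ffun 'I_m * 'I_m -> bool})%type.
(* Up to relabelling the arcs by 'I_m, the value depends only on which arcs
     follow each other and which share their source. *)
pose codes (G : digraph) (e : E) (h : 'I_m -> arcs G) :=
  [/\ bijective h, forall i j, e.1 (i, j) = (tgt (h i) == src (h j)) &
      forall i j, e.2 (i, j) = (src (h i) == src (h j))].
pose is_code (e : E) G := strongly_connected G /\ #|arcs G| = m /\
  exists h, codes G e h.
have codable G : strongly_connected G /\ #|arcs G| = m -> exists e, is_code e G.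
  move=> [scG cG].
  pose h i : arcs G := enum_val (cast_ord (esym cG) i).
  exists ([ffun p => tgt (h p.1) == src (h p.2)],
          [ffun p => src (h p.1) == src (h p.2)]).
  split=> //; split=> //; exists h; split=> [|i j|i j]; rewrite ?ffunE //.
  exists (fun a => cast_ord cG (enum_rank a)) => [i|a].
    by rewrite /h enum_valK cast_ordKV.
  by rewrite /h cast_ordK enum_rankK.
have cyc_trans e G H h k : codes G e h -> codes H e k ->
    forall c : seq 'I_m, directed_cycle (map h c) = directed_cycle (map k c).
  move=> [bh h1 h2] [bk k1 k2] c; rewrite /directed_cycle -!map_comp.
  congr [&& _, _ & _]; first by case: c.
    rewrite !cycle_map; apply: eq_cycle => i j /=.
    by rewrite -h1 k1.
  elim: c => //= i c ->; congr (~~ _ && _).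
  by apply/mapP/mapP => -[j jc /= /eqP]; rewrite -?h2 -?k2 => eij; exists j;
    rewrite //; apply/eqP; rewrite /= -?h2 -?k2.
have sums_sub e G H : is_code e G -> is_code e H -> arc_sums G `<=` arc_sums H.
  move=> [_ [_ [h hP]]] [_ [_ [k kP]]] _ [x [x0 xcyc] <-].
  have [[h' hK h'K] _ _] := hP; have [[k' kK k'K] _ _] := kP.
  exists (fun b => x (h (k' b))); last first.
    rewrite (reindex k); last by exists k' => ? _.
    rewrite [RHS](reindex h); last by exists h' => ? _.
    by apply: eq_bigr => i _; rewrite kK.
  split=> [b|c cP]; first exact: x0.
  have -> : c = map k (map k' c) by rewrite mapK.
  rewrite big_map (eq_bigr (fun i => x (h i))); last by move=> i _; rewrite kK.
  rewrite -(big_map h xpredT x); apply: xcyc.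
  by rewrite (cyc_trans e _ _ _ _ hP kP) mapK.
have code_inv e G H : is_code e G -> is_code e H -> min_arc_sum G = min_arc_sum H.
  by move=> eG eH; congr inf; apply/seteqP; split; apply: (sums_sub e).
pose L := @Digraph unit 'I_m (fun=> tt) (fun=> tt).
have LP : strongly_connected L /\ #|arcs L| = m.
  by split; [move=> [] []; exact: connect0 | exact: card_ord].
have [e0 e0L] := codable L LP.
pose val e : R := xget 0 [set r | exists G, is_code e G /\ r = min_arc_sum G].
have valE e G : is_code e G -> val e = min_arc_sum G.
  rewrite /val => eG; case: xgetP => [r _ [H [eH ->]]|noval].
    exact: (code_inv e).
  by case: (noval (min_arc_sum G)); exists G.
pose P e := `[< exists G, is_code e G >].
have Pe0 : P e0 by apply/asboolP; exists L.
case: (@arg_minP _ _ E e0 P val Pe0) => e /asboolP[G eG] emin.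
have Gmin H : strongly_connected H /\ #|arcs H| = m ->
    min_arc_sum G <= min_arc_sum H.
  move=> HP; have [e' e'H] := codable H HP.
  by rewrite -(valE e G eG) -(valE e' H e'H); apply: emin; apply/asboolP; exists H.
have GP : strongly_connected G /\ #|arcs G| = m by case: eG => ? [].
exists G => //; split=> //; symmetry; apply: inf_min; first by exists G; case: GP.
by move=> _ [H [scH cH ->]]; exact: Gmin.
Qed.

End MinSum.

(* Main.v *)
Require Import Defs.
From mathcomp Require Import all_boot all_order all_algebra.
From mathcomp Require Import all_classical all_reals all_analysis.
From mathcomp Require Import ring lra zify.
Import Order.TTheory GRing.Theory Num.Theory.
Import numFieldNormedType.Exports.
Local Open Scope classical_set_scope.
Local Open Scope ring_scope.

(* Let x be a minimizer, a an arc with x_a least, c a cycle through a, n its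
   length, and q = m + 1 - n. The n - 1 arcs of c other than a, together with
   the number q x_a, which bounds from below the sum over the q arcs that are
   not among them, have product q; AM-GM gives f >= n q^(1/n). Calculus then
   yields n (m + 1 - n)^(1/n) > e ln(m - ln m) for all 1 <= n <= m.
   Conversely, n q^(1/n) with n close to ln m is attained, up to replacing q by
   m, on a directed path with n - 1 arcs closed by q parallel back arcs; the
   map n |-> n m^(1/n) has a critical point at n = ln m with value e ln m, so
   rounding n to an integer costs only O(1 / ln m). *)

Set Implicit Arguments.
Unset Strict Implicit.
Unset Printing Implicit Defensive.

(** * Exponential estimates *)

Section Exp.
Variable R : realType.
Implicit Types a b x z c : R.

(** Concavity: the right side is the tangent of [ln] at [expR c]. It is used at e^0, e^1 and e^2. *)
Lemma ln_tangent c z : 0 < z -> ln z <= z * expR (- c) + c - 1.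
Proof.
move=> z0; have := expR_ge1Dx (ln z - c).
by rewrite expRD lnK ?posrE //; lra.
Qed.

Lemma ln_le_subr1 z : 0 < z -> ln z <= z - 1.
Proof. by move=> /(ln_tangent 0); rewrite oppr0 expR0; lra. Qed.

Lemma ln_sub_le a b : 0 < a -> 0 < b -> ln a - ln b <= (a - b) / b.
Proof.
move=> a0 b0; rewrite -ln_div ?posrE //.
apply: le_trans (ln_le_subr1 (divr_gt0 a0 b0)) _.
by rewrite mulrBl divff // gt_eqF.
Qed.

Lemma expR1_gt : (5 / 2 : R) < expR 1.
Proof.
have -> : (expR 1 : R) = expR (1 / 8) ^+ 8.
  by rewrite -expRM_natl; congr expR; lra.
apply: (@lt_le_trans _ _ ((9 / 8) ^+ 8)); first lra.
rewrite lerXn2r ?nnegrE ?expR_ge0 //.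
by have := expR_ge1Dx (1 / 8 : R); lra.
Qed.

Lemma expR1_lt : (expR 1 : R) < 14 / 5.
Proof.
have : (5 / 14 : R) < expR (- 1).
  (* (1 - 1/k)^k bounds 1/e from below; k = 32 is large enough to exceed 5/14. *)
  have -> : (expR (- 1) : R) = expR (- 1 / 32) ^+ 32.
    by rewrite -expRM_natl; congr expR; lra.
  apply: (@lt_le_trans _ _ ((31 / 32) ^+ 32)); first lra.
  rewrite lerXn2r ?nnegrE ?expR_ge0 //.
  by have := expR_ge1Dx (- 1 / 32 : R); lra.
have := expRxMexpNx_1 (1 : R); have := expR_gt0 (1 : R).
nra.
Qed.

(** Replacing e by the larger rational 14/5 reduces lower bounds on [ln] to rational arithmetic. *)
Lemma lt_ln_nat (k : nat) x : (14 / 5) ^+ k.+1 < x -> k.+1%:R < ln x.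
Proof.
move=> kx; have x0 : 0 < x by apply: lt_trans kx; rewrite exprn_gt0 //; lra.
rewrite -ltr_expR lnK ?posrE //; apply: lt_trans kx.
rewrite -[k.+1%:R]mulr1 expRM_natl ltrXn2r ?expR_ge0 //=; last exact: expR1_lt.
Qed.

Lemma eln_le_id z : 0 < z -> expR 1 * ln z <= z.
Proof.
move=> /(ln_tangent 1); rewrite addrK expRN mulrC.
by rewrite ler_pdivlMl ?expR_gt0.
Qed.

Lemma eln_tangent_sqr_expR1 z : 0 < z ->
  expR 1 * ln z <= z * expR (- 1) + expR 1.
Proof.
move=> z0; have := ln_tangent 2 z0.
have -> : expR (- 2) = expR (- 1) * expR (- 1) :> R.
  by rewrite -expRD; congr expR; lra.
move=> h.
have E := expRxMexpNx_1 (1 : R).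
have := ler_wpM2l (expR_ge0 (1:R)) h.
set e := expR 1 in E *; set f := expR (- 1) in E *.
have -> : e * (z * (f * f) + 2 - 1) = z * f * (e * f) + e by ring.
by rewrite E mulr1.
Qed.

(** Squaring exp(x/2) >= 1 + x/2 keeps the quadratic gain x^2/4 over the tangent; [-2 <= x] makes
    the base nonnegative. *)
Lemma expR_ge_sqr x : -2 <= x -> (1 + x / 2) ^+ 2 <= expR x.
Proof.
move=> x2; have {2}-> : x = 2%:R * (x / 2) by lra.
rewrite expRM_natl lerXn2r ?nnegrE ?expR_ge0 ?expR_ge1Dx //; lra.
Qed.

End Exp.

(** * The calculus inequality for n q^(1/n) with n + q = m + 1 *)

Section CycleValue.
Variable R : realType.

(** The right side is n + ln q at n = m/2 + 1, q = m/2, the extreme point of the long-cycle case of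
    [cycle_value_gt]. *)
Lemma eln_sub_ln_lt (m : nat) : (1 < m)%N ->
  expR 1 * ln (m%:R - ln m%:R) < m%:R / 2 + 1 + ln (m%:R / 2) :> R.
Proof.
move=> m2; set M : R := m%:R; have M2 : 2 <= M by rewrite ler_nat.
have z0 : 0 < M - ln M by rewrite subr_gt0 ln_sublinear //; lra.
have lnM_ge0 : 0 <= ln M by apply: ln_ge0; lra.
have E : expR 1 * expR (- 1) = 1 :> R by rewrite expRxMexpNx_1.
have e1 := expR1_gt R; have e2 := expR1_lt R.
have lnM2 k : (14 / 5) ^+ k.+1 < M ^+ 2 / 2 -> k.+1%:R < ln M + ln (M / 2).
  move=> kM; rewrite -lnM ?posrE; [|lra|lra].
  by rewrite mulrA -expr2 lt_ln_nat.
(* For m >= 8 the tangent at e^2 and [ln (M / 2) > 1] reduce the claim to e < M/10 + 2, where M >= 8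
   and e < 14/5 suffice. For smaller m, e ln z <= z leaves a numerical check on ln(M^2/2). *)
have [m8|m7] := leqP 8 m.
  have M8 : 8 <= M by rewrite ler_nat.
  have l4 : 1%:R < ln (M / 2) by apply: lt_ln_nat; rewrite expr1; lra.
  apply: le_lt_trans (eln_tangent_sqr_expR1 z0) _.
  have f0 : 0 < expR (- 1) :> R by exact: expR_gt0.
  have f1 : expR (- 1) < 2 / 5 :> R by nra.
  have : (M - ln M) * expR (- 1) <= M * (2 / 5) by nra.
  lra.
apply: le_lt_trans (eln_le_id z0) _.
have : M - M / 2 - 1 < ln M + ln (M / 2); last lra.
have cases : [\/ m = 2%N, m = 3%N, (4 <= m <= 6)%N | m = 7%N].
  move: m2 m7; clear; case: m => [|[|[|[|m]]]] // _ m7;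
    [exact: Or41|exact: Or42|].
  have [m4|m4] := leqP m.+4 6; first exact: Or43.
  by apply: Or44; apply/eqP; rewrite eqn_leq m4 andbT.
case: cases => [m2E|m3E|/andP[m4 m6]|m7E].
- have ln2 : 0 < ln (2 : R) by apply: ln_gt0; lra.
  by rewrite /M m2E divff // ln1; lra.
- have ME : M = 3 by rewrite /M m3E.
  have : 1%:R < ln M + ln (M / 2) by apply: lnM2; rewrite ME; lra.
  lra.
- have M4 : 4 <= M by rewrite ler_nat.
  have M6 : M <= 6 by rewrite ler_nat.
  have : 2%:R < ln M + ln (M / 2) by apply: lnM2; nra.
  lra.
- have ME : M = 7 by rewrite /M m7E.
  have : 3%:R < ln M + ln (M / 2) by apply: lnM2; rewrite ME; lra.
  lra.
Qed.

Lemma cycle_value_gt (m n q : nat) : (0 < n)%N -> (0 < q)%N ->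
  (n + q = m.+1)%N ->
  expR 1 * ln (m%:R - ln m%:R) < n%:R * expR (ln q%:R / n%:R) :> R.
Proof.
move=> n0 q0 nqm.
have [m1|m2] := leqP m 1.
  have mE : m = 1%N by lia.
  by rewrite mE ln1 subr0 ln1 mulr0 mulr_gt0 ?expR_gt0 // ltr0n.
pose M : R := m%:R; pose N : R := n%:R; pose Q : R := q%:R.
rewrite -/M -/N -/Q.
have NQ : N + Q = M + 1 by rewrite /N /Q /M -natrD nqm -addn1 natrD.
have M2 : 2 <= M by rewrite ler_nat.
have N1 : 1 <= N by rewrite ler1n.
have Q1 : 1 <= Q by rewrite ler1n.
have N0 : N != 0 by rewrite gt_eqF //; lra.
have L0 : 0 < ln M by apply: ln_gt0; lra.
have l0 : 0 <= ln Q by apply: ln_ge0.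
have z0 : 0 < M - ln M by rewrite subr_gt0 ln_sublinear //; lra.
have e0 := expR_gt0 (1 : R).
have linear : N + ln Q <= N * expR (ln Q / N).
  have -> : N + ln Q = N * (1 + ln Q / N) by field.
  by rewrite ler_pM2l ?expR_ge1Dx //; lra.
have [NL|LN] := ltP (N - 1) (ln M).
  (* Here Q > M - ln M, and n exp(l / n) >= e l suffices. *)
  have -> : N * expR (ln Q / N) = N * expR (1 + (ln Q / N - 1)).
    by congr (_ * expR _); lra.
  apply: (@lt_le_trans _ _ (expR 1 * ln Q)).
    rewrite ltr_pM2l // ltr_ln ?posrE //; lra.
  rewrite expRD mulrCA ler_pM2l //.
  have -> : ln Q = N * (1 + (ln Q / N - 1)) by field.
  rewrite ler_pM2l; last lra.
  have -> : N * (1 + (ln Q / N - 1)) / N - 1 = ln Q / N - 1 by field.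
  exact: expR_ge1Dx.
have [big|small] := leP (M + 2) (2 * N).
  (* As 1 <= Q <= M/2, passing from M/2 down to Q lowers the logarithm by at most M/2 - Q, exactly
     what N gains over M/2 + 1. *)
  apply: lt_le_trans linear; apply: lt_le_trans (eln_sub_ln_lt m2) _.
  rewrite -/M.
  have Q0 : 0 < Q by lra.
  have M20 : 0 < M / 2 by lra.
  have := ln_sub_le M20 Q0.
  have : (M / 2 - Q) / Q <= M / 2 - Q by rewrite ler_pdivrMr //; nra.
  lra.
(* Remaining case, 1 + ln M <= N <= Q: the second-order gain in
   n exp(l / n) >= e (l + (n - l)^2 / (4 n)) outweighs the loss
   ln (M - ln M) - ln Q <= d / N, where d = N - 1 - ln M and l = ln Q, as
   (1 + d)^2 >= 4 d. *)
have QN : N <= Q.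
  have : (2 * n < m + 2)%N by rewrite -(ltr_nat R) natrD natrM.
  by rewrite ler_nat; lia.
have Q0 : 0 < Q by lra.
have lam : ln (M - ln M) <= ln Q + (N - 1 - ln M) / N.
  have := ln_sub_le z0 Q0.
  have -> : M - ln M - Q = N - 1 - ln M by lra.
  have : (N - 1 - ln M) / Q <= (N - 1 - ln M) / N.
    by apply: ler_wpM2l; [lra | rewrite lef_pV2 ?posrE //; lra].
  lra.
have lamL : ln (M - ln M) < ln M by rewrite ltr_ln ?posrE //; lra.
have l_lam : ln Q <= ln (M - ln M) by rewrite ler_ln ?posrE //; lra.
have -> : N * expR (ln Q / N) = expR 1 * (N * expR (ln Q / N - 1)).
  by rewrite mulrCA -expRD; congr (_ * expR _); lra.
rewrite ltr_pM2l //.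
have lN0 : 0 <= ln Q / N by rewrite divr_ge0 //; lra.
have sqr : (1 + (ln Q / N - 1) / 2) ^+ 2 <= expR (ln Q / N - 1).
  by apply: expR_ge_sqr; lra.
have : N * (1 + (ln Q / N - 1) / 2) ^+ 2 <= N * expR (ln Q / N - 1).
  by rewrite ler_pM2l //; lra.
apply: lt_le_trans; apply: le_lt_trans lam _.
have -> : N * (1 + (ln Q / N - 1) / 2) ^+ 2 = ln Q + (N - ln Q) ^+ 2 / 4 / N.
  by field.
rewrite ltrD2l ltr_pM2r ?invr_gt0; last lra.
have D : 1 + (N - 1 - ln M) < N - ln Q by lra.
have : (1 + (N - 1 - ln M)) ^+ 2 < (N - ln Q) ^+ 2.
  by rewrite ltrXn2r ?nnegrE //; lra.
by have := sqr_ge0 (1 - (N - 1 - ln M)); rewrite !expr2; lra.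
Qed.

End CycleValue.

(** * Cycles and admissible vectors *)

(** The bordering arcs [a] and [b] stay free so that both can later be the one arc that closes the
    path into a cycle. *)
Lemma path_arcs (G : digraph) (p : seq (nodes G)) (u : nodes G) :
  path (@Defs.adjacent G) u p ->
  exists2 c : seq (arcs G), map (@src G) c = belast u p &
    forall a b, tgt a = u -> src b = last u p ->
      path (fun a b => tgt a == src b) a (rcons c b).
Proof.
elim: p u => [|v p IH] u /=.
  by move=> _; exists [::] => //= a b -> <-; rewrite eqxx.
case/andP=> /existsP[a0 /andP[/eqP su /eqP tv]] /IH[c <- cP].
exists (a0 :: c) => /= [|a b -> lb]; first by rewrite su.
by rewrite su eqxx cP.
Qed.

Lemma arc_in_cycle (G : digraph) (a : arcs G) : strongly_connected G ->
  exists c, directed_cycle (a :: c).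
Proof.
move=> /(_ (tgt a) (src a)) /connectP[p pP ap].
case: (shortenP pP) ap => p' p'P p'u _ ap.
have [c srcc cP] := path_arcs p'P.
(* The sources of [c] are all nodes of the simple path but the last, and the last is the source of
   [a]. *)
exists c; rewrite /directed_cycle /= cP // srcc -rcons_uniq.
by rewrite ap -lastI.
Qed.

Lemma path_src_tgt (G : digraph) (c : seq (arcs G)) a b :
  path (fun a b => tgt a == src b) a (rcons c b) ->
  map (@tgt G) (a :: c) = map (@src G) (rcons c b).
Proof.
elim: c a => [|a' c IH] a /=; first by case/andP => /eqP ->.
by case/andP => /eqP -> /IH /= ->.
Qed.

(* The product telescopes along every cycle. *)
Lemma admissible_potential (R : realType) (G : digraph) (p : nodes G -> R) :
  (forall v, 0 < p v) -> admissible (fun a => p (tgt a) / p (src a)).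
Proof.
move=> p0; split=> [a|[//|a c] /and3P[_ /path_src_tgt E _]].
  by rewrite divr_ge0 // ltW.
rewrite prodf_div -(big_map (@tgt G) xpredT p) E map_rcons.
rewrite -(big_map (@src G) xpredT p) /= (perm_big _ (permEl (perm_rcons _ _))).
by rewrite divff // prodf_seq_neq0; apply/allP => v _; rewrite gt_eqF.
Qed.

(** AM-GM: add the tangent bounds of [ln] at the geometric mean exp(l/n). Over the whole list the
    terms in l cancel. *)
Lemma AGM_exp (R : realType) (s : seq R) (n : nat) : n = size s -> (0 < n)%N ->
  (forall x, x \in s -> 0 < x) ->
  n%:R * expR (ln (\prod_(x <- s) x) / n%:R) <= \sum_(x <- s) x.
Proof.
move=> ns n0 s0; have N0 : (n%:R : R) != 0 by rewrite pnatr_eq0 -lt0n.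
set l := ln _; pose r := expR (- (l / n%:R)).
have tangent (t : seq R) : (forall x, x \in t -> 0 < x) ->
    (size t)%:R - (size t)%:R * (l / n%:R) + ln (\prod_(x <- t) x) <=
    (\sum_(x <- t) x) * r /\ 0 < \prod_(x <- t) x.
  elim: t => [|x t IH] t0 /=; first by rewrite !big_nil ln1; split=> //; lra.
  have x0 : 0 < x by apply: t0; rewrite mem_head.
  have [|IH1 IH2] := IH.
    by move=> y yt; apply: t0; rewrite in_cons yt orbT.
  rewrite !big_cons mulr_gt0 //; split=> //.
  rewrite lnM ?posrE // -add1n natrD.
  have := expR_ge1Dx (ln x - l / n%:R); rewrite expRD lnK ?posrE // -/r.
  lra.
have [+ _] := tangent s s0; rewrite -ns -/l mulrCA divff // mulr1 subrK.
by rewrite /r expRN ler_pdivlMr ?expR_gt0 //.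
Qed.

Lemma min_arc_sum_ge (R : realType) (G : digraph) : strongly_connected G ->
  (0 < #|arcs G|)%N ->
  exists n q : nat, [/\ (0 < n)%N, (0 < q)%N, (n + q = #|arcs G|.+1)%N &
    n%:R * expR (ln q%:R / n%:R) <= min_arc_sum R G].
Proof.
move=> scG /card_gt0P[a1 _].
have [x [x0 xcyc] [<- _]] := min_arc_sum_attained R G.
pose a := [arg min_(i < a1 | true) x i]%O.
have amin b : x a <= x b by rewrite /a; case: arg_minP => // i _; apply.
have [c cP] := arc_in_cycle a scG.
have cprod := xcyc _ cP.
have xpos b : b \in a :: c -> 0 < x b.
  move=> bc; rewrite lt_def x0 andbT; apply/eqP => xb0.
  move/eqP: cprod; rewrite (big_rem b) //= xb0 mul0r eq_sym.
  by rewrite oner_eq0.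
have cu : uniq (a :: c) by case/and3P: cP => _ _ /map_uniq.
have cc : uniq c by case/andP: cu.
have szc : #|c| = size c by apply/card_uniqP.
(* Since [c] omits [a], the arc [a] is itself among these q arcs; hence q >= 1 and n + q = m + 1. *)
pose q := #|[predC c]|.
have cardE : (size c + q)%N = #|arcs G| by rewrite -szc cardC.
have q0 : (0 < q)%N by apply/card_gt0P; exists a; case/andP: cu.
exists (size c).+1, q; split=> //; first by rewrite addSn cardE.
pose s := q%:R * x a :: map x c.
have sizes : (size c).+1 = size s by rewrite /= size_map.
have prods : \prod_(y <- s) y = q%:R.
  by rewrite big_cons big_map -mulrA -[X in _ * X](big_cons _ _ _ _ xpredT)
    cprod mulr1.
have := @AGM_exp R s _ sizes isT; rewrite prods => /(_ _)/le_trans; apply.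
  move=> y; rewrite in_cons => /orP[/eqP->|/mapP[b bc ->]].
    by rewrite mulr_gt0 ?ltr0n // xpos // mem_head.
  by rewrite xpos // in_cons bc orbT.
rewrite big_cons big_map (big_uniq _ cc) [leRHS](bigID (mem c)) /=
  [leRHS]addrC lerD2r.
rewrite mulr_natl -sumr_const; apply: ler_sum => b _; exact: amin.
Qed.

(* The path 0 -> 1 -> .. -> k followed by m - k parallel arcs
   k -> 0 (for k < m). *)
Definition path_with_back_arcs (m k : nat) : digraph :=
  @Digraph 'I_k.+1 'I_m (fun i => inord (minn i k))
    (fun i => if (i < k)%N then inord i.+1 else ord0).

Lemma path_with_back_arcs_strongly_connected (m k : nat) : (k < m)%N ->
  strongly_connected (path_with_back_arcs m k).
Proof.
move=> km.
pose e := @Defs.adjacent (path_with_back_arcs m k).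
have step i (im : (i < m)%N) : e (inord (minn i k))
    (if (i < k)%N then inord i.+1 else ord0).
  by apply/existsP; exists (Ordinal im); rewrite /= !eqxx.
have up i j : (i + j <= k)%N ->
    connect e (inord i) (inord (i + j)).
  elim: j => [|j IH] ijk; first by rewrite addn0 connect0.
  apply: connect_trans (IH _) (connect1 _); first by lia.
  have im : (i + j < m)%N by lia.
  have ijk' : (i + j < k)%N by rewrite -addnS.
  by have := step _ im; rewrite ijk' (minn_idPl (ltnW ijk')) addnS.
have back : connect e (inord k) (inord 0).
  apply: connect1; have := step _ km.
  rewrite minnn ltnn (_ : ord0 = inord 0) //.
  by apply/val_inj; rewrite /= inordK.
move=> u v; rewrite -(inord_val u) -(inord_val v).
have := ltn_ord u; have := ltn_ord v; rewrite !ltnS => vk uk.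
apply: connect_trans (connect_trans _ back) _; last exact: (up 0%N).
by have := up u (k - u)%N; rewrite subnKC //; apply.
Qed.

(** With r = m^(1/(k+1)), the potential r^v gives each path arc the value r and each back arc r^(-k)
    = r/m, in total k r + (m - k) r/m <= (k + 1) r. *)
Lemma min_over_graphs_le (R : realType) (m k : nat) : (k < m)%N ->
  min_over_graphs R m <= k.+1%:R * expR (ln m%:R / k.+1%:R).
Proof.
move=> km; have m0 : (0 < m)%N by lia.
have [G _ [<- Gmin]] := min_over_graphs_attained R m0.
apply: le_trans (Gmin (path_with_back_arcs m k) _) _.
  by split; [exact: path_with_back_arcs_strongly_connected | rewrite card_ord].
have [x _ [<- xmin]] := min_arc_sum_attained R (path_with_back_arcs m k).
set r := expR _; have r0 : 0 < r by exact: expR_gt0.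
apply: le_trans (xmin _ (@admissible_potential R (path_with_back_arcs m k)
  (fun v => r ^+ (v : 'I_k.+1)) _)) _; first by move=> v; rewrite exprn_gt0.
have rk : r ^+ k.+1 = m%:R.
  rewrite /r -expRM_natl mulrC divfK ?pnatr_eq0 // lnK // posrE ltr0n //.
have -> : \sum_(a : arcs (path_with_back_arcs m k))
     r ^+ (tgt a : 'I_k.+1) / r ^+ (src a : 'I_k.+1) =
   \sum_(0 <= i < m) (if (i < k)%N then r else r / m%:R).
  rewrite big_mkord; apply: eq_bigr => i _ /=.
  case: ltnP => ik.
    rewrite !inordK ?ltnS //; last exact: ltnW.
    by rewrite exprS mulfK // gt_eqF ?exprn_gt0.
  rewrite inordK // expr0 -rk exprS invfM mulrA divff ?gt_eqF //.
rewrite (big_cat_nat (n := k)) //=; last exact: ltnW.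
rewrite (eq_big_nat _ _ (F2 := fun=> r)); last by move=> i /andP[_ ->].
rewrite [X in _ + X](eq_big_nat _ _ (F2 := fun=> r / m%:R)); last first.
  by move=> i /andP[ki _]; rewrite ltnNge ki.
rewrite !sumr_const_nat subn0 -[r *+ k]mulr_natl -[_ *+ (m - k)]mulr_natl.
rewrite -natr1 mulrDl mul1r lerD2l mulrCA ger_pMr //.
by rewrite ler_pdivrMr ?ltr0n // mul1r ler_nat leq_subr.
Qed.

(** * Bounds in terms of the number of arcs *)

Section Asymptotics.
Variable R : realType.

Lemma min_arc_sum_gt (G : digraph) : strongly_connected G ->
  (0 < #|arcs G|)%N ->
  expR 1 * ln (#|arcs G|%:R - ln #|arcs G|%:R) < min_arc_sum R G.
Proof.
move=> scG m0; have [n [q [n0 q0 nq le_min]]] := min_arc_sum_ge R scG m0.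
exact: lt_le_trans (cycle_value_gt R n0 q0 nq) le_min.
Qed.

Lemma min_over_graphs_gt (m : nat) : (0 < m)%N ->
  expR 1 * ln (m%:R - ln m%:R) < min_over_graphs R m.
Proof.
move=> m0; have [G [scG Gm] [<- _]] := min_over_graphs_attained R m0.
by rewrite -Gm min_arc_sum_gt // Gm.
Qed.

Lemma min_over_graphs_upper (m : nat) : (1 < m)%N ->
  min_over_graphs R m <= expR 1 * ln m%:R + expR 1 / ln m%:R.
Proof.
move=> m1; set L : R := ln m%:R.
have L0 : 0 < L by apply: ln_gt0; rewrite ltr1n.
(* The cycle length N = k + 1 then satisfies L < N <= L + 1. *)
pose k := Num.truncn L.
have /andP[kL Lk] : k%:R <= L < k.+1%:R by apply: truncn_itv; exact: ltW.
have km : (k < m)%N.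
  rewrite -(ltr_nat R); apply: le_lt_trans kL _.
  by apply: ln_sublinear; rewrite ltr0n ltnW.
apply: le_trans (min_over_graphs_le R km) _; rewrite -/L.
move: Lk; set N : R := k.+1%:R => LN.
have N1 : N <= L + 1 by rewrite /N -natr1 lerD2r.
have N0 : N != 0 by rewrite gt_eqF //; lra.
pose y : R := 1 - L / N.
have y0 : 0 <= y by rewrite subr_ge0 ler_pdivrMr ?mul1r ?ltr0n // ltW.
have -> : N * expR (L / N) = expR 1 * (N * expR (- y)).
  by rewrite mulrCA -expRD; congr (_ * expR _); rewrite /y subKr.
rewrite -mulrDr ler_pM2l ?expR_gt0 //.
(* Via exp(-y) <= 1/(1 + y). As N y = N - L, the first-order terms leave L and the error is (N -
   L)^2 / N <= 1/L. *)
have expNy : expR (- y) <= 1 - y + y ^+ 2.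
  have y1 : 0 < 1 + y by lra.
  rewrite -(ler_pM2l y1); apply: (@le_trans _ _ 1).
    by rewrite -[leRHS](expRxMexpNx_1 y) ler_pM2r ?expR_gt0 // expR_ge1Dx.
  have -> : (1 + y) * (1 - y + y ^+ 2) = 1 + y ^+ 3 by ring.
  by rewrite lerDl exprn_ge0.
have : N * expR (- y) <= N * (1 - y + y ^+ 2) by rewrite ler_pM2l //; lra.
move/le_trans; apply.
have -> : N * (1 - y + y ^+ 2) = L + (N - L) ^+ 2 / N by rewrite /y; field.
rewrite lerD2l; apply: (@le_trans _ _ N^-1).
  by rewrite ler_piMl ?invr_ge0; [|lra|rewrite expr2; nra].
by rewrite lef_pV2 ?posrE; lra.
Qed.

(** The loss ln M - ln(M - L) is at most L/(M - L) <= 2L/M, by L <= M/2; then L^2 <= 4M, from ln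
    sqrt(M) <= sqrt(M) - 1, turns it into 8/L. *)
Lemma eln_sub_ln_ge (m : nat) : (1 < m)%N ->
  expR 1 * ln m%:R - 8 * expR 1 / ln m%:R <=
  expR 1 * ln (m%:R - ln m%:R) :> R.
Proof.
move=> m1; set M : R := m%:R; set L := ln M.
have M2 : 2 <= M by rewrite ler_nat.
have L0 : 0 < L by apply: ln_gt0; lra.
have M0 : 0 < M by lra.
have sqrt0 : 0 < Num.sqrt M by rewrite sqrtr_gt0.
have LM : L ^+ 2 <= 4 * M.
  have LE : L = ln (Num.sqrt M) + ln (Num.sqrt M).
    by rewrite -lnM ?posrE // -expr2 sqr_sqrtr // ltW.
  have := ln_le_subr1 sqrt0; have := sqr_sqrtr (ltW M0); rewrite !expr2; nra.
have half : M / 2 <= M - L.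
  have M20 : 0 < M / 2 by lra.
  have := ln_le_subr1 M20; rewrite ln_div ?posrE //.
  by have := @ln_le_subr1 R 2; rewrite -/L; lra.
have z0 : 0 < M - L by lra.
have h := ln_sub_le M0 z0.
rewrite -mulrA [8 * _]mulrC -mulrA -mulrBr ler_pM2l ?expR_gt0 //.
rewrite lerBlDl -lerBlDr; apply: le_trans h _.
have -> : M - (M - L) = L by lra.
rewrite ler_pdivrMr // -mulrA ler_pdivlMl //.
by rewrite -expr2; lra.
Qed.

End Asymptotics.

Theorem mainTheorem3 (R : realType) :
  (forall (m : nat) (G : digraph), (1 <= m)%N ->
     strongly_connected G -> #|arcs G| = m ->
     min_arc_sum R G > expR 1 * ln (m%:R - ln m%:R)) /\
  (fun m : nat => min_over_graphs R m : R^o) =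
    (fun m : nat => expR 1 * ln m%:R : R^o) +O_\oo
    (fun m : nat => (ln m%:R)^-1 : R^o).
Proof.
split=> [m G m0 scG Gm|]; first by rewrite -Gm min_arc_sum_gt // Gm.
(* The lower bound costs 8e / ln m and the upper one only e / ln m, so 8e serves for both. *)
apply/eqaddOP; exists (8 * expR 1); split; first by rewrite num_real.
move=> C C8; near=> m.
have m1 : (1 < m)%N by near: m; exact: nbhs_infty_gt.
have L0 : 0 < ln (m%:R : R) by apply: ln_gt0; rewrite ltr1n.
have iL0 : 0 < (ln (m%:R : R))^-1 by rewrite invr_gt0.
have e0 := expR_gt0 (1 : R).
rewrite /= (gtr0_norm iL0).
apply: (@le_trans _ _ (8 * expR 1 / ln m%:R)); last by rewrite ler_pM2r // ltW.
have up := min_over_graphs_upper R m1.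
have lo := le_trans (eln_sub_ln_ge R m1) (ltW (min_over_graphs_gt R (ltnW m1))).
have : expR 1 / ln m%:R <= 8 * expR 1 / ln (m%:R : R).
  by rewrite ler_pM2r //; lra.
rewrite [X in `|X|](_ : _ = min_over_graphs R m - expR 1 * ln m%:R) //.
by rewrite ler_norml; lra.
Unshelve. all: by end_near.
Qed.
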